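(* Let $(X,d)$ be a compact metric space and let $f\colon X\to X$ be a homeomorphism. Suppose that there is a closed subset $\Lambda$ of $X$ with $f(\Lambda)=\Lambda$ such that (i) $\Lambda$ is an uncountable set, (ii) $f$ is expansive on $B_b(\Lambda)$ and has shadowing on $B_b(\Lambda)$ for some $b>0$. Then $f$ is Bohr chaotic.
   Context: For a closed subset $S$ of a compact metric space $(X,d)$ and $r>0$, $B_r(S)=\{x\in X\colon d(x,S)\le r\}$, where $d(x,S)=\inf_{s\in S}d(x,s)$. For a homeomorphism $f\colon X\to X$ and $x\in X$, $\mathcal{O}_f(x)=\{f^i(x)\colon i\in\mathbb{Z}\}$. Expansiveness on a subset: for $S\subset X$, $f$ is expansive on $S$ if there is $e>0$ such that, for all $x,y\in S$ with $\mathcal{O}_f(x)\cup\mathcal{O}_f(y)\subset S$, $\sup_{i\in\mathbb{Z}}d(f^i(x),f^i(y))\le e$ implies $x=y$. Shadowing on a subset: for $\delta>0$, a sequence $(x_i)_{i\in\mathbb{Z}}$ in $X$ is a $\delta$-pseudo orbit of $f$ if $\sup_{i\in\mathbb{Z}}d(f(x_i),x_{i+1})\le\delta$; it is $\epsilon$-shadowed by $x\in X$ if $\sup_{i\in\mathbb{Z}}d(x_i,f^i(x))\le\epsilon$. For a subset $S\subset X$, $f$ has shadowing on $S$ if for any $\epsilon>0$ there is $\delta>0$ such that every $\delta$-pseudo orbit $(x_i)_{i\in\mathbb{Z}}$ of $f$ with $x_i\in S$ for all $i\in\mathbb{Z}$ is $\epsilon$-shadowed by some $x\in X$ (the shadowing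 point need not lie in $S$). Bohr chaos: let $C(X)$ be the set of continuous real-valued functions on $X$. A continuous map $f\colon X\to X$ is Bohr chaotic if for every bounded sequence $(a_i)_{i\ge0}$ of real numbers with $\limsup_{n\to\infty}\frac1n\sum_{i=0}^{n-1}|a_i|>0$ there are $x\in X$ and $\phi\in C(X)$ with $\limsup_{n\to\infty}\frac1n\left|\sum_{i=0}^{n-1}a_i\phi(f^i(x))\right|>0$. *)

(* Defs.v *)
From mathcomp Require Export all_boot all_order all_algebra.
From mathcomp Require Export all_classical all_reals all_analysis.
Export Order.TTheory GRing.Theory Num.Theory.
Export numFieldNormedType.Exports.

Set Implicit Arguments.
Unset Strict Implicit.
Unset Printing Implicit Defensive.

Local Open Scope classical_set_scope.
Local Open Scope ring_scope.

(* ['pinv_id [set: X] f] is a total function; it is the inverse of [f]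
   when [f] is bijective. *)
Definition finverse (X : choiceType) (f : X -> X) : X -> X :=
  'pinv_id [set: X] f.

Definition homeomorphism (X : topologicalType) (f : X -> X) : Prop :=
  [/\ set_bij [set: X] [set: X] f, continuous f & continuous (finverse f)].

(* [iterz f i] is f^i for i in Z; [Negz n] stands for -(n+1). *)
Definition iterz (X : choiceType) (f : X -> X) (i : int) : X -> X :=
  match i with
  | Posz n => iter n f
  | Negz n => iter n.+1 (finverse f)
  end.

Definition orbitz (X : choiceType) (f : X -> X) (x : X) : set X :=
  range (fun i : int => iterz f i x).

(* Infima and suprema are taken in [\bar R]: no boundedness side condition is
   needed, and the distance to the empty set is +oo. *)
Definition dist_to (R : realType) (X : metricType R) (x : X) (S : set X)
  : \bar R := ereal_inf [set (mdist x s)%:E | s in S].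

Definition cball_around (R : realType) (X : metricType R) (r : R) (S : set X)
  : set X := [set x | (dist_to x S <= r%:E)%E].

Definition sup_dist (R : realType) (X : metricType R) (u v : int -> X)
  : \bar R := ereal_sup (range (fun i : int => (mdist (u i) (v i))%:E)).

Definition expansive_on (R : realType) (X : metricType R) (f : X -> X)
    (S : set X) : Prop :=
  exists2 e : R, 0 < e &
    forall x y : X, S x -> S y -> orbitz f x `|` orbitz f y `<=` S ->
      (sup_dist (iterz f ^~ x) (iterz f ^~ y) <= e%:E)%E -> x = y.

Definition pseudo_orbit (R : realType) (X : metricType R) (f : X -> X)
    (delta : R) (u : int -> X) : Prop :=
  (sup_dist (f \o u) (fun i => u (i + 1)%R) <= delta%:E)%E.

Definition shadowed_by (R : realType) (X : metricType R) (f : X -> X)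
    (eps : R) (u : int -> X) (x : X) : Prop :=
  (sup_dist u (iterz f ^~ x) <= eps%:E)%E.

Definition shadowing_on (R : realType) (X : metricType R) (f : X -> X)
    (S : set X) : Prop :=
  forall eps : R, 0 < eps ->
    exists2 delta : R, 0 < delta &
      forall u : int -> X, pseudo_orbit f delta u -> (forall i, S (u i)) ->
        exists x : X, shadowed_by f eps u x.

(* The term n = 0 of the averages below is 0 and does not affect the limits
   superior, which are taken in [\bar R]. *)
Definition bohr_chaotic (R : realType) (X : topologicalType) (f : X -> X)
  : Prop :=
  forall a : nat -> R, bounded_fun a ->
    (0 < limn_esup (fun n =>
       (n%:R^-1 * \sum_(0 <= i < n) `|a i|)%R%:E))%E ->
    exists (x : X) (phi : X -> R), continuous phi /\
      (0 < limn_esup (fun n =>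
         (n%:R^-1 * `|\sum_(0 <= i < n) a i * phi (iter i f x)|)%R%:E))%E.

(* Main.v *)
Require Import Defs.
From mathcomp Require Import zify ring lra.

(** Code each point of L by nearest points of a finite net, so that the codes
are pseudo orbits. If any two loops of equal length in the net with the same
base point stayed close at all times, then the code of a point would be
determined, up to expansiveness, by a finite word between a symbol recurring
in the past and one recurring in the future, and L would be countable. Hence
there are separated loops [c], [c'] at a common base point. Shadowing
[... c c c ...] gives a periodic point [q], and shadowing [... c c c' c c ...]
gives a point [p <> q] homoclinic to [q]; in particular [p] is isolated in the
union of the orbits of [p] and [q]. Shadowing concatenations of long pieces of
these two orbits, one finds orbits which visit the support of a bump function
[phi] at [p] exactly along any prescribed set of times in a fixed residue class
modulo some [M]. Splitting the times according to the residue modulo [M] and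
the sign of [a_i], one of the resulting 2M points detects (a_i). *)

Set Implicit Arguments.
Unset Strict Implicit.
Unset Printing Implicit Defensive.

Local Open Scope classical_set_scope.
Local Open Scope ring_scope.


(** * Distances and integer iterates *)

Section Metric.
Context {R : realType} {X : metricType R}.
Implicit Types (x y z : X) (S : set X) (u v : int -> X).

Lemma sup_distP u v (c : R) :
  (sup_dist u v <= c%:E)%E <-> forall i, mdist (u i) (v i) <= c.
Proof.
split=> [/ereal_supP uv i|uv]; first by rewrite -lee_fin; apply: uv; exists i.
by apply/ereal_supP => _ [i _ <-]; rewrite lee_fin.
Qed.

Lemma cball_aroundP r S x y : S y -> mdist x y <= r -> cball_around r S x.
Proof.
move=> Sy xy; rewrite /cball_around /dist_to /=.
apply: (@le_trans _ _ (mdist x y)%:E); last by rewrite lee_fin.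
by apply: ereal_inf_lbound; exists y.
Qed.

Lemma mdist_near x (r : R) : 0 < r -> \forall y \near x, mdist x y < r.
Proof.
by move=> r0; have := nbhsx_ballx x _ r0; rewrite ballEmdist.
Qed.

Lemma continuous_mdistr x : continuous (fun y => mdist x y : R).
Proof.
move=> y; apply/cvgrPdist_le => e e0.
near=> z; have yz : mdist y z < e by near: z; exact: mdist_near.
rewrite ler_distl; have := metric_triangle x y z.
have := metric_triangle x z y; rewrite (metric_sym z y).
by move=> *; lra.
Unshelve. all: by end_near. Qed.

(* The filter of finite sets ordered by inclusion stands in for finite subcovers,
   because [compact_cover] requires a pointed type. *)
Lemma finite_net S (P : X -> X -> Prop) : compact S ->
  (forall x, S x -> \forall y \near x, P x y) ->
  exists s : seq X, forall y, S y -> exists2 x, x \in s & S x /\ P x y.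
Proof.
move=> /compact_near_coveringP cS SP.
pose F := filter_from setT (fun s0 : seq X => [set s : seq X | {subset s0 <= s}]).
have FF : Filter F.
  apply: filter_fromT_filter; first by exists [::].
  move=> s t; exists (s ++ t) => w /= stw.
  by split=> z zs; apply: stw; rewrite mem_cat zs ?orbT.
have [x Sx|s0 _ s0P] := cS _ F (fun (s : seq X) y => exists2 x, x \in s & S x /\ P x y) FF.
  exists (P x, [set s : seq X | {subset [:: x] <= s}]) => /=.
    by split; [exact: SP|exists [:: x]].
  move=> [y s] /= [Pxy xs]; exists x => //; apply: xs; exact: mem_head.
by exists s0 => y Sy; apply: (s0P s0) => //.
Qed.

End Metric.

Section Iterz.
Context {X : topologicalType} (f : X -> X) (f_homeo : homeomorphism f).

Lemma homeomorphismK : cancel f (finverse f).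
Proof.
case: f_homeo => -[_ fI _] _ _ x.
by rewrite /finverse pinvKV ?in_setE.
Qed.

Lemma homeomorphismVK : cancel (finverse f) f.
Proof.
case: f_homeo => -[_ _ fS] _ _ x.
by rewrite /finverse (surjpK _ fS) ?in_setE.
Qed.

Lemma iterz_succ (i : int) x : iterz f (i + 1) x = f (iterz f i x).
Proof.
case: i => [n|[|n]]; first by rewrite -PoszD addn1.
  by rewrite [RHS]/= homeomorphismVK.
have -> : Negz n.+1 + 1 = Negz n by lia.
by rewrite [RHS]/= homeomorphismVK.
Qed.

Lemma iterz_pred (i : int) x : iterz f (i - 1) x = finverse f (iterz f i x).
Proof. by rewrite -{2}(subrK 1 i) iterz_succ homeomorphismK. Qed.

Lemma iterzD (i j : int) x : iterz f (i + j) x = iterz f i (iterz f j x).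
Proof.
elim/int_ind: i => [|n IH|n IH]; first by rewrite add0r.
  by rewrite -addn1 PoszD addrAC !iterz_succ IH.
by rewrite -addn1 PoszD opprD addrAC !iterz_pred IH.
Qed.

Lemma continuous_iterz (i : int) : continuous (iterz f i).
Proof.
case: f_homeo => _ cf cV.
have citer g : continuous g -> forall n, continuous (iter n g : X -> X).
  move=> cg; elim=> [|n IH] x; first exact: cvg_id.
  by apply: (@continuous_comp _ _ _ (iter n g) g); [exact: IH|exact: cg].
by case: i => n; apply: citer.
Qed.

Lemma iterz_stable (L : set X) (i : int) x : f @` L = L -> L x -> L (iterz f i x).
Proof.
move=> fL Lx.
have LV y : L y -> L (finverse f y).
  by rewrite -{1}fL => -[z Lz <-]; rewrite homeomorphismK.
have Lf y : L y -> L (f y) by rewrite -{2}fL => Ly; exists y.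
case: i => n; first by elim: n => //= n; exact: Lf.
by rewrite /iterz; elim: n.+1 => //= k; exact: LV.
Qed.

Lemma iterz_mul_fixed (i k : int) x : iterz f i x = x -> iterz f (k * i) x = x.
Proof.
move=> ix.
elim/int_ind: k => [|n IH|n IH]; first by rewrite mul0r.
  by rewrite -addn1 PoszD mulrDl mul1r iterzD ix.
rewrite -[RHS]IH -addn1 PoszD opprD mulrBl mul1r iterzD; congr iterz.
by rewrite -{1}ix -iterzD addNr.
Qed.

End Iterz.


(** * Closed chains and pigeonhole principles *)

Section Chains.
Context {R : realType} {X : metricType R}.
Variables (f : X -> X) (delta : R) (S : set X).
Implicit Types (v : X) (c : nat -> X).

Definition closed_chain v (n : nat) c := [/\ c 0%N = v, c n = v,
  forall r, (r < n)%N -> S (c r) &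
  forall r, (r < n)%N -> mdist (f (c r)) (c r.+1) <= delta].

Definition cat_chain (n : nat) c c' (r : nat) :=
  if (r < n)%N then c r else c' (r - n)%N.

Lemma closed_chain_cat v n n' c c' :
  closed_chain v n c -> closed_chain v n' c' ->
  closed_chain v (n + n') (cat_chain n c c').
Proof.
move=> [c0 cn cS cd] [c0' cn' cS' cd']; rewrite /cat_chain; split.
- by case: ltnP => //; rewrite leqn0 => /eqP ->.
- by rewrite ltnNge leq_addr /= addKn.
- by move=> r rn; case: ltnP => [|nr]; [exact: cS|apply: cS'; lia].
- move=> r rn; case: (ltnP r n) => rn1; case: (ltnP r.+1 n) => rn2.
  + exact: cd.
  + have <- : c r.+1 = c' (r.+1 - n)%N; last exact: cd.
    have -> : (r.+1 = n)%N by lia.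
    by rewrite cn subnn c0'.
  + lia.
  + by rewrite subSn //; apply: cd'; lia.
Qed.

Definition separated_chains (e : R) := exists v (N : nat) c c' (j : nat),
  [/\ closed_chain v N c, closed_chain v N c', (j < N)%N &
      e < mdist (c j) (c' j)].

(* Concatenating in both orders equalizes the lengths. *)
Lemma separated_forward e v n n' c c' (j : nat) :
  closed_chain v n c -> closed_chain v n' c' ->
  (j < n)%N -> (j < n')%N -> e < mdist (c j) (c' j) -> separated_chains e.
Proof.
move=> cc cc' jn jn' ej.
exists v, (n + n')%N, (cat_chain n c c'), (cat_chain n' c' c), j; split.
- exact: closed_chain_cat.
- by rewrite addnC; exact: closed_chain_cat.
- lia.
- by rewrite /cat_chain jn jn'.
Qed.

(** Mirror image of [separated_forward]: the two concatenations now end with [c] and [c'], so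
    positions counted from the end stay aligned. The condition [0 < j] keeps the index below the
    total length. *)
Lemma separated_backward e v n n' c c' (j : nat) :
  closed_chain v n c -> closed_chain v n' c' ->
  (0 < j <= n)%N -> (j <= n')%N ->
  e < mdist (c (n - j)%N) (c' (n' - j)%N) -> separated_chains e.
Proof.
move=> cc cc' jn jn' ej.
exists v, (n + n')%N, (cat_chain n' c' c), (cat_chain n c c'), (n + n' - j)%N.
split.
- by rewrite addnC; exact: closed_chain_cat.
- exact: closed_chain_cat.
- lia.
- rewrite /cat_chain !ifF; try lia.
  have -> : (n + n' - j - n' = n - j)%N by lia.
  by have -> : (n + n' - j - n = n' - j)%N by lia.
Qed.

End Chains.

Lemma infinitely_often (T : eqType) (s : seq T) (g : nat -> T) :
  (forall n, g n \in s) -> exists v, forall K, exists2 n, (K <= n)%N & g n = v.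
Proof.
move=> gs; apply: contrapT => /forallNP nv.
have late : exists K, forall n, (K <= n)%N -> g n \notin s.
  elim: s {gs} => [|v s [K IH]]; first by exists 0%N.
  have /existsNP[K' K'P] := nv v.
  exists (maxn K K') => n; rewrite geq_max inE => /andP[Kn K'n].
  rewrite negb_or IH // andbT; apply/eqP => gv.
  by apply: K'P; exists n.
by have [K /(_ K (leqnn K))] := late; rewrite gs.
Qed.

(** [D] is a relation because a point may admit many descriptions [t]. If no two points shared one,
    picking a description for each point would inject [L] into the naturals. *)
Lemma uncountable_pigeonhole (T : Type) (U : countType) (L : set T)
    (D : T -> U -> Prop) : ~ countable L ->
  (forall x, L x -> exists t, D x t) ->
  exists x y t, [/\ L x, L y, x <> y, D x t & D y t].
Proof.
move=> Lunc LD; apply: contrapT => none; apply: Lunc; apply/countable_injP.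
have /choice[g gP] : forall x, exists n, L x -> exists2 t, D x t & pickle t = n.
  move=> x; have [Lx|nLx] := pselect (L x); last by exists 0%N.
  by have [t Dt] := LD x Lx; exists (pickle t) => _; exists t.
exists g => x y; rewrite !inE => Lx Ly gxy.
have [t Dxt tx] := gP x Lx; have [t' Dyt' ty] := gP y Ly.
have tt' : t = t' by apply: (pcan_inj pickleK); rewrite tx ty.
apply: contrapT => xy; apply: none; exists x, y, t; split=> //.
by rewrite tt'.
Qed.


(** * Two separated loops *)

Section Coding.
Context {R : realType} {X : metricType R}.
Variables (f : X -> X) (L : set X) (delta : R) (xi : X -> int -> X).
Hypothesis L_code : forall x i, L x -> L (xi x i).
Hypothesis code_step : forall x i, L x -> mdist (f (xi x i)) (xi x (i + 1)) <= delta.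

Let code_chain x (i : int) (n : nat) : L x -> xi x (i + n%:Z) = xi x i ->
  closed_chain f delta L (xi x i) n (fun r => xi x (i + r%:Z)).
Proof.
move=> Lx xn; split=> //; first by rewrite addr0.
- by move=> r _; exact: L_code.
- by move=> r _; rewrite -addn1 PoszD addrA; exact: code_step.
Qed.

(** If the codes were far apart at time [m + j], cut both at a later return to their common symbol
    at [m]: this yields two loops at that symbol, separated at the same index [j]. *)
Lemma code_close_forward x y (m : nat) (e : R) : L x -> L y ->
  ~ separated_chains f delta L e -> xi x m = xi y m ->
  (forall K, exists2 n, (K <= n)%N & xi x n%:Z = xi x m) ->
  (forall K, exists2 n, (K <= n)%N & xi y n%:Z = xi y m) ->
  forall i : int, m%:Z <= i -> mdist (xi x i) (xi y i) <= e.
Proof.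
move=> Lx Ly nosep xym rx ry i mi; rewrite leNgt; apply/negP => sep.
have [j ij] : exists j : nat, i = m%:Z + j%:Z.
  by exists `|i - m%:Z|%N; lia.
have [n mjn xn] := rx (m + j).+1; have [n' mjn' yn] := ry (m + j).+1.
have nE : m%:Z + (n - m)%N%:Z = n%:Z by lia.
have n'E : m%:Z + (n' - m)%N%:Z = n'%:Z by lia.
have cx := @code_chain x m (n - m)%N Lx; rewrite nE in cx.
have cy := @code_chain y m (n' - m)%N Ly; rewrite n'E -xym in cy.
have yn' : xi y n' = xi x m by rewrite xym.
apply: nosep; apply: (separated_forward (cx xn) (cy yn') (j := j)).
- by move: mjn; clear; lia.
- by move: mjn'; clear; lia.
- by rewrite -ij.
Qed.

(** Time reversal of the forward case: the loops run from a past return up to time [- l], so [j]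
    counts from their ends. *)
Lemma code_close_backward x y (l : nat) (e : R) : L x -> L y -> 0 <= e ->
  ~ separated_chains f delta L e -> xi x (- l%:Z) = xi y (- l%:Z) ->
  (forall K, exists2 n, (K <= n)%N & xi x (- n%:Z) = xi x (- l%:Z)) ->
  (forall K, exists2 n, (K <= n)%N & xi y (- n%:Z) = xi y (- l%:Z)) ->
  forall i : int, i <= - l%:Z -> mdist (xi x i) (xi y i) <= e.
Proof.
move=> Lx Ly e0 nosep xyl rx ry i il; rewrite leNgt; apply/negP => sep.
have [j ij] : exists j : nat, i = - l%:Z - j%:Z.
  by exists `|(i + l%:Z)%R|%N; move: il; clear; lia.
have [j0|j0] := posnP j.
  by move: sep; rewrite ij j0 subr0 xyl mdistxx ltNge e0.
have [n ljn xn] := rx (l + j)%N; have [n' ljn' yn] := ry (l + j)%N.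
have nE : - n%:Z + (n - l)%N%:Z = - l%:Z by move: ljn; clear; lia.
have n'E : - n'%:Z + (n' - l)%N%:Z = - l%:Z by move: ljn'; clear; lia.
have cx := @code_chain x (- n%:Z) (n - l)%N Lx; rewrite nE xn in cx.
have cy := @code_chain y (- n'%:Z) (n' - l)%N Ly; rewrite n'E yn -xyl in cy.
have {}cx := cx erefl; have {}cy := cy erefl.
apply: nosep; apply: (separated_backward cx cy (j := j)).
- by move: ljn j0; clear; lia.
- by move: ljn' j0; clear; lia.
- have -> : - n%:Z + (n - l - j)%N%:Z = i by move: ljn j0 ij; clear; lia.
  by have -> : - n'%:Z + (n' - l - j)%N%:Z = i by move: ljn' j0 ij; clear; lia.
Qed.

End Coding.

Lemma exists_separated_chains (R : realType) (X : metricType R) (f : X -> X)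
    (L : set X) (e delta : R) :
  compact [set: X] -> homeomorphism f -> closed L -> f @` L = L ->
  ~ countable L -> 0 < e -> 0 < delta ->
  (forall x y, L x -> L y ->
    (forall i, mdist (iterz f i x) (iterz f i y) <= e) -> x = y) ->
  separated_chains f delta L (e / 2).
Proof.
move=> cX hf cL fL Lunc e0 d0 Lexp; apply: contrapT => nosep.
(* With [e / 4], two coding errors plus [e / 2] stay within [e]; with [delta / 2], the two errors in
   one step of the code add up to at most [delta]. *)
pose g := Num.min (e / 4) (delta / 2).
have g0 : 0 < g by rewrite lt_min; apply/andP; split; lra.
have ge : g <= e / 4 by rewrite ge_min lexx.
have gd : g <= delta / 2 by rewrite ge_min lexx orbT.
have cf : continuous f by case: hf.
(* Closeness of the images is built into the net, so the codes become pseudo orbits without a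
   modulus of continuity. *)
pose P x y := mdist x y < g /\ mdist (f x) (f y) < g.
have cLc : compact L by apply: (subclosed_compact cL cX).
have [s sP] : exists s : seq X, forall y, L y -> exists2 x, x \in s & L x /\ P x y.
  apply: finite_net => // x Lx; near=> y; split; near: y; first exact: mdist_near.
  exact: (cf x _ (mdist_near (f x) g0)).
have /choice[c cP] : forall y, exists x, L y -> [/\ x \in s, L x & P x y].
  move=> y; have [Ly|nLy] := pselect (L y); last by exists y.
  by have [x xs [Lx Px]] := sP y Ly; exists x.
have Lit x i : L x -> L (iterz f i x) by exact: iterz_stable.
pose xi x i := c (iterz f i x).
have xi_s x i : L x -> xi x i \in s by move=> /(Lit _ i)/cP[].
have xi_L x i : L x -> L (xi x i) by move=> /(Lit _ i)/cP[].
have xi_near x i : L x -> mdist (xi x i) (iterz f i x) < g.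
  by move=> /(Lit _ i)/cP[_ _ []].
have xi_step x i : L x -> mdist (f (xi x i)) (xi x (i + 1)) <= delta.
  move=> Lx; have [_ _ [_ h1]] := cP _ (Lit _ i Lx).
  have := xi_near x (i + 1) Lx; rewrite iterz_succ // metric_sym => h2.
  have := metric_triangle (f (xi x i)) (f (iterz f i x)) (xi x (i + 1)).
  rewrite /xi in h1 h2 *; lra.
(* Time [m] carries a symbol recurring in the future, time [- l] one recurring in the past, and [w]
   lists the code in between as indices in [s]; such descriptions range over a countable type. *)
pose D x (t : nat * nat * seq nat) := let: (l, m, w) := t in
  [/\ w = mkseq (fun r => index (xi x (r%:Z - l%:Z)) s) (l + m).+1,
   forall K, exists2 n, (K <= n)%N & xi x n%:Z = xi x m%:Z &
   forall K, exists2 n, (K <= n)%N & xi x (- n%:Z) = xi x (- l%:Z)].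
have [x|x [y [[[l m] w] [Lx Ly xy]]]] := @uncountable_pigeonhole _ _ _ D Lunc.
  move=> Lx.
  have [v vP] := infinitely_often (fun n : nat => xi_s x n%:Z Lx).
  have [u uP] := infinitely_often (fun n : nat => xi_s x (- n%:Z) Lx).
  have [m _ mv] := vP 0%N; have [l _ lu] := uP 0%N.
  exists (l, m, mkseq (fun r => index (xi x (r%:Z - l%:Z)) s) (l + m).+1).
  by rewrite /D mv lu.
case=> xw xf xb [yw yf yb].
have mid (i : int) : - l%:Z <= i <= m%:Z -> xi x i = xi y i.
  move=> ilm; pose r := `|(i + l%:Z)%R|%N.
  have rlm : (r < (l + m).+1)%N by rewrite /r; move: ilm; clear; lia.
  have ir : i = r%:Z - l%:Z by rewrite /r; move: ilm; clear; lia.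
  have : nth 0%N w r = nth 0%N w r by [].
  rewrite {1}xw yw !nth_mkseq // -ir.
  exact: (index_inj x (xi_s x i Lx) (xi_s y i Ly)).
apply: xy; apply: Lexp => // i.
(* Between [- l] and [m] the codes agree; outside, the absence of separated loops keeps them
   [e / 2]-close. *)
have xyi : mdist (xi x i) (xi y i) <= e / 2.
  have e20 : 0 <= e / 2 by lra.
  have [im|mi] := leP i m%:Z; last first.
    apply: (code_close_forward xi_L xi_step Lx Ly nosep _ xf yf); last exact: ltW.
    by apply: mid; clear; lia.
  have [li|il] := leP (- l%:Z) i; first by rewrite mid ?li ?im // mdistxx.
  apply: (code_close_backward xi_L xi_step Lx Ly e20 nosep _ xb yb).
    by apply: mid; clear; lia.
  exact: ltW.
have h1 := xi_near x i Lx; have h2 := xi_near y i Ly.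
have h3 := metric_triangle (iterz f i x) (xi x i) (iterz f i y).
have h4 := metric_triangle (xi x i) (xi y i) (iterz f i y).
move: h1 h2 h3 h4 xyi; rewrite (metric_sym (iterz f i x) (xi x i)); lra.
Unshelve. all: by end_near. Qed.


(** * A homoclinic point *)

Lemma divz_block (N : nat) (k : int) (r : nat) : (r < N)%N ->
  ((k * N%:Z + r%:Z) %/ N%:Z)%Z = k.
Proof.
move=> rN; rewrite divzMDl; last by lia.
by rewrite divz_nat divn_small // addr0.
Qed.

Lemma modz_block (N : nat) (k : int) (r : nat) : (r < N)%N ->
  ((k * N%:Z + r%:Z) %% N%:Z)%Z = r.
Proof. by move=> rN; rewrite modzMDl modz_nat modn_small. Qed.

Lemma blockP (N : nat) (i : int) : (0 < N)%N ->
  exists k (r : nat), (r < N)%N /\ i = k * N%:Z + r%:Z.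
Proof.
move=> N0; exists (i %/ N%:Z)%Z, `|(i %% N%:Z)%Z|%N.
have ge0 : 0 <= (i %% N%:Z)%Z by apply: modz_ge0; lia.
have ltN : (i %% N%:Z)%Z < N%:Z by apply: ltz_pmod; lia.
split; first by lia.
by rewrite {1}(divz_eq i N%:Z) gez0_abs.
Qed.

Section Blocks.
Context {X : Type}.
Variables (N : nat) (w : int -> nat -> X).

(** Bi-infinite concatenation of words of length [N]; Euclidean division starts word [k] at time
    [k * N], for negative [k] as well. *)
Definition blocks (i : int) : X := w (i %/ N%:Z)%Z `|(i %% N%:Z)%Z|%N.

Lemma blocksE k (r : nat) : (r < N)%N -> blocks (k * N%:Z + r%:Z) = w k r.
Proof. by move=> rN; rewrite /blocks divz_block // modz_block. Qed.

End Blocks.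

Lemma pseudo_orbit_blocks (R : realType) (X : metricType R) (f : X -> X)
    (delta : R) (N : nat) (w : int -> nat -> X) : (0 < N)%N ->
  (forall k r, (r.+1 < N)%N -> mdist (f (w k r)) (w k r.+1) <= delta) ->
  (forall k, mdist (f (w k N.-1)) (w (k + 1) 0%N) <= delta) ->
  pseudo_orbit f delta (blocks N w).
Proof.
move=> N0 w_in w_end; apply/sup_distP => i /=.
have [k [r [rN ->]]] := blockP i N0.
rewrite blocksE //; have [rN1|Nr] := ltnP r.+1 N.
  by rewrite -addrA -PoszD addn1 blocksE //; exact: w_in.
have rE : r = N.-1 by lia.
have -> : k * N%:Z + r%:Z + 1 = (k + 1) * N%:Z + 0%N%:Z.
  by rewrite mulrDl mul1r; lia.
by rewrite blocksE // rE; exact: w_end.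
Qed.

Section Homoclinic.
Context {R : realType} {X : metricType R} {f : X -> X}.
Hypothesis X_compact : compact [set: X].
Hypothesis f_homeo : homeomorphism f.

(** In a compact Hausdorff space a sequence with a single cluster point converges to it. By
    continuity, the orbit of a cluster point [y] stays within [c] of that of [q], so [y = q]. *)
Lemma cvg_iterz_fixed (p q : X) (T : int) (c : R) :
  (forall y, (forall j, mdist (iterz f j y) (iterz f j q) <= c) -> y = q) ->
  (forall j : int, \forall k \near \oo,
     mdist (iterz f (j + k%:Z * T) p) (iterz f j q) <= c) ->
  (fun k : nat => iterz f (k%:Z * T) p) @ \oo --> q.
Proof.
move=> q_unique pq; set F := (X in X --> q).
have FP : ProperFilter F by exact: fmap_proper_filter.
have clq y : cluster F y -> y = q.
  move=> cly; apply: q_unique => j; rewrite leNgt; apply/negP => cj.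
  pose r := mdist (iterz f j y) (iterz f j q) - c.
  have r0 : 0 < r by rewrite subr_gt0.
  have [|z [/= zq yz]] := cly [set z | mdist (iterz f j z) (iterz f j q) <= c]
      [set z | mdist (iterz f j y) (iterz f j z) < r] _
      (@continuous_iterz _ f f_homeo j y _ (mdist_near _ r0)).
    have := pq j; apply: filterS => k /=.
    by rewrite iterzD.
  have := metric_triangle (iterz f j y) (iterz f j z) (iterz f j q).
  rewrite /r in yz; lra.
apply: (compact_cluster_set1 (@metric_hausdorff R X) X_compact) => //.
- exact: filterT.
- exact: filterT.
apply/seteqP; split=> [y /clq //|_ ->].
have [y [_ cly]] := X_compact FP filterT.
by rewrite -(clq y cly).
Qed.

(** Both orbits are kept in the ball because shadowing will be applied again, to pieces of them. *)
Lemma exists_homoclinic (L : set X) (b : R) :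
  closed L -> f @` L = L -> ~ countable L -> 0 < b ->
  expansive_on f (cball_around b L) -> shadowing_on f (cball_around b L) ->
  exists (N : nat) (p q : X), [/\ (0 < N)%N /\ iterz f N%:Z q = q, p <> q,
    forall i, cball_around b L (iterz f i p) /\ cball_around b L (iterz f i q),
    (fun k : nat => iterz f (k%:Z * N%:Z) p) @ \oo --> q &
    (fun k : nat => iterz f (k%:Z * - N%:Z) p) @ \oo --> q].
Proof.
move=> cL fL Lunc b0 [e e0 fexp] fsh.
(* Shadowing orbits are compared up to [2 * eps]: [e / 8] keeps this below the separation [e / 2]
   and within the expansive constant [e]. With [b / 3], an orbit [2 * eps]-close to that of [q],
   hence [3 * eps]-close to points of [L], remains in the ball. *)
pose eps := Num.min (e / 8) (b / 3).
have eps0 : 0 < eps by rewrite lt_min; apply/andP; split; lra.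
have epse : eps <= e / 8 by rewrite ge_min lexx.
have epsb : eps <= b / 3 by rewrite ge_min lexx orbT.
have {fexp} fexp x y : (forall i, cball_around b L (iterz f i x)) ->
    (forall i, cball_around b L (iterz f i y)) ->
    (forall i, mdist (iterz f i x) (iterz f i y) <= e) -> x = y.
  move=> xL yL xy; apply: fexp; [exact: xL 0|exact: yL 0| |exact/sup_distP].
  by move=> _ [[i _ <-]|[i _ <-]].
have LB x : L x -> cball_around b L x.
  by move=> Lx; apply: (cball_aroundP Lx); rewrite mdistxx ltW.
have [delta delta0 fshadow] := fsh eps eps0.
have [|v [N [c [c' [j [[c0 cN cS cd] [c0' cN' cS' cd'] jN sep]]]]]] :=
    exists_separated_chains X_compact f_homeo cL fL Lunc e0 delta0.
  by move=> x y Lx Ly; apply: fexp => i; apply: LB; exact: iterz_stable.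
have N0 : (0 < N)%N by lia.
(* Both loops start and end at [v], so any bi-infinite concatenation of [c] and [c'] is a
   [delta]-pseudo orbit in [L]. *)
have shadow (w : int -> nat -> X) : (forall k, w k = c \/ w k = c') ->
    (forall i, L (blocks N w i)) /\
    exists x, forall i, mdist (blocks N w i) (iterz f i x) <= eps.
  move=> wE.
  have wL i : L (blocks N w i).
    have [k [r [rN ->]]] := blockP i N0.
    by rewrite blocksE //; case: (wE k) => ->; auto.
  split=> //; have [||x /sup_distP] := fshadow (blocks N w); last by exists x.
    have w0 k : w k 0%N = v by case: (wE k) => ->.
    apply: pseudo_orbit_blocks => // k => [r rN|].
      by case: (wE k) => ->; [apply: cd|apply: cd']; exact: ltnW.
    have NE : N = N.-1.+1 by rewrite prednK.
    rewrite w0; case: (wE k) => ->.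
      by rewrite -cN {2}NE; apply: cd; rewrite -NE.
    by rewrite -cN' {2}NE; apply: cd'; rewrite -NE.
  by move=> i; exact: LB.
pose wq (k : int) := c; pose wp (k : int) := if k == 0 then c' else c.
have [uqL [q qP]] := shadow wq (fun _ => or_introl erefl).
have [|upL [p pP]] := shadow wp.
  by move=> k; rewrite /wp; case: ifP => _; [right|left].
have uq_period k (r : nat) : (r < N)%N ->
    blocks N wq (k * N%:Z + r%:Z) = c r by move=> rN; rewrite blocksE.
have ball2 y : (forall i, mdist (iterz f i y) (iterz f i q) <= 2 * eps) ->
    forall i, cball_around b L (iterz f i y).
  move=> yq i; apply: (cball_aroundP (uqL i)).
  have := metric_triangle (iterz f i y) (iterz f i q) (blocks N wq i).
  rewrite (metric_sym (iterz f i q) (blocks _ _ _)).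
  have := qP i; have := yq i; lra.
have qB : forall i, cball_around b L (iterz f i q).
  by apply: ball2 => i; rewrite mdistxx; lra.
have pB i : cball_around b L (iterz f i p).
  apply: (cball_aroundP (upL i)); rewrite metric_sym.
  have := pP i; lra.
have q_unique y : (forall i, mdist (iterz f i y) (iterz f i q) <= 2 * eps) -> y = q.
  move=> yq; apply: fexp => // [|i]; first exact: ball2.
  by apply: (le_trans (yq i)); lra.
(* The shadowed pseudo orbit has period [N], so [f^N(q)] shadows it too and its orbit stays within
   [2 * eps] of that of [q]. *)
have qN : iterz f N%:Z q = q.
  apply: q_unique => i; rewrite -iterzD //.
  have [k [r [rN ->]]] := blockP i N0.
  have := qP (k * N%:Z + r%:Z); have := qP ((k + 1) * N%:Z + r%:Z).
  rewrite !uq_period // mulrDl mul1r -!addrA (addrC N%:Z).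
  have := metric_triangle (iterz f (k * N%:Z + (r%:Z + N%:Z)) q) (c r)
    (iterz f (k * N%:Z + r%:Z) q).
  rewrite (metric_sym _ (c r)); lra.
have pcvg (s : int) : s != 0 ->
    (fun k : nat => iterz f (k%:Z * (s * N%:Z)) p) @ \oo --> q.
  move=> s0; apply: (cvg_iterz_fixed q_unique) => i.
  have [k0 [r [rN iE]]] := blockP i N0.
  (* Beyond [|k0|] the shift has moved block [k0] off block 0, the only one where [wp] and [wq] can
     differ. *)
  near=> k; have k0k : (`|k0| < k)%N by near: k; exact: nbhs_infty_gt.
  have -> : i + k%:Z * (s * N%:Z) = (k0 + k%:Z * s) * N%:Z + r%:Z.
    by rewrite iE mulrDl mulrA addrAC.
  have := pP ((k0 + k%:Z * s) * N%:Z + r%:Z); have := qP i.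
  rewrite iE blocksE // blocksE // /wp ifF; last first.
    by apply/eqP; move: s0 k0k; clear; nia.
  have := metric_triangle (iterz f ((k0 + k%:Z * s) * N%:Z + r%:Z) p) (c r)
    (iterz f (k0 * N%:Z + r%:Z) q).
  rewrite (metric_sym _ (c r)) /wq; lra.
exists N, p, q; split=> //; first last.
- by have := pcvg (- 1) isT; under eq_fun do rewrite mulN1r.
- by have := pcvg 1 isT; under eq_fun do rewrite mul1r.
(* If [p = q], one point would be [eps]-close to both [c j] and [c' j], against their separation. *)
move=> pq; move: sep; apply/negP; rewrite -leNgt.
have := pP (0 * N%:Z + j%:Z); have := qP (0 * N%:Z + j%:Z).
rewrite !blocksE // /wq /wp eqxx pq.
have := metric_triangle (c j) (iterz f (0 * N%:Z + j%:Z) q) (c' j).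
rewrite (metric_sym (iterz _ _ _) (c' j)); lra.
Unshelve. all: by end_near. Qed.

End Homoclinic.


(** * Realizing prescribed visiting times *)

Section Marker.
Context {R : realType} {X : metricType R}.

(** Each of the [N] residue classes eventually stays at least half as far from [p] as its limit; the
    remaining finitely many terms have a positive minimal distance to [p]. *)
Lemma sequence_away (p : X) (N : nat) (g h : nat -> X) : (0 < N)%N ->
  (forall i, g i <> p) -> (forall r, h r <> p) ->
  (forall r, (fun k => g (k * N + r)%N) @ \oo --> h r) ->
  exists2 eta : R, 0 < eta & forall i, eta <= mdist p (g i).
Proof.
move=> N0 gp hp gh.
have tail M : exists2 eta : R, 0 < eta & exists K, forall r k,
    (r < M)%N -> (K <= k)%N -> eta <= mdist p (g (k * N + r)%N).
  elim: M => [|M [eta eta0 [K etaP]]]; first by exists 1 => //; exists 0%N.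
  have d0 : 0 < mdist p (h M) by rewrite mdist_gt0; apply/eqP/nesym.
  have [K' _ K'P] := metricType_numDomainType.cvgr_dist_lt (gh M) (divr_gt0 d0 (ltr0n _ 2)).
  exists (Num.min eta (mdist p (h M) / 2)); first by rewrite lt_min eta0 divr_gt0.
  exists (maxn K K') => r k; rewrite ltnS leq_eqVlt geq_max ge_min.
  move=> /orP[/eqP ->|rM] /andP[Kk K'k]; last by rewrite etaP.
  have := K'P k K'k; have := metric_triangle p (g (k * N + M)%N) (h M).
  rewrite /= (metric_sym (g _) (h M)) => *; apply/orP; right; lra.
have head M : exists2 eta : R, 0 < eta & forall i, (i < M)%N -> eta <= mdist p (g i).
  elim: M => [|M [eta eta0 etaP]]; first by exists 1.
  have d0 : 0 < mdist p (g M) by rewrite mdist_gt0; apply/eqP/nesym.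
  exists (Num.min eta (mdist p (g M))); first by rewrite lt_min eta0.
  move=> i; rewrite ltnS leq_eqVlt ge_min => /orP[/eqP ->|iM].
    by rewrite lexx orbT.
  by rewrite etaP.
have [e1 e10 [K e1P]] := tail N; have [e2 e20 e2P] := head (K * N)%N.
exists (Num.min e1 e2) => [|i]; first by rewrite lt_min e10.
rewrite ge_min; have [iKN|KNi] := ltnP i (K * N)%N; first by rewrite e2P ?orbT.
rewrite {1}(divn_eq i N) e1P ?ltn_pmod //.
by rewrite leq_divRL.
Qed.

Variables (f : X -> X) (f_homeo : homeomorphism f).
Variables (N : nat) (p q : X).
Hypothesis N_gt0 : (0 < N)%N.
Hypothesis qN : iterz f N%:Z q = q.
Hypothesis pq : p <> q.
Hypothesis p_forward : (fun k : nat => iterz f (k%:Z * N%:Z) p) @ \oo --> q.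
Hypothesis p_backward : (fun k : nat => iterz f (k%:Z * - N%:Z) p) @ \oo --> q.

(** If [f^i(p) = p], the sequence tending to [q] returns to [p] at every multiple of [|i|], forcing
    [p = q]. *)
Lemma homoclinic_aperiodic (i : int) : i != 0 -> iterz f i p <> p.
Proof.
move=> i0 ip.
have d0 : 0 < mdist q p by rewrite mdist_gt0; apply/eqP/nesym.
have [K _ /(_ (K * `|i|)%N)] := metricType_numDomainType.cvgr_dist_lt p_forward d0.
have -> : iterz f ((K * `|i|)%N%:Z * N%:Z) p = p.
  have -> : (K * `|i|)%N%:Z * N%:Z = (K%:Z * Num.sg i * N%:Z) * i.
    by rewrite PoszM abszE normrEsg; ring.
  exact: iterz_mul_fixed.
by rewrite /= ltxx leq_pmulr ?absz_gt0 // => /(_ isT).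
Qed.

Lemma homoclinic_not_periodic (i : int) : iterz f i q <> p.
Proof.
move=> qp; apply: (@homoclinic_aperiodic N%:Z); first by lia.
by rewrite -qp -iterzD // addrC iterzD // qN.
Qed.

Lemma iterz_period (k : int) (r : nat) : iterz f (k * N%:Z + r%:Z) q = iterz f r%:Z q.
Proof. by rewrite addrC iterzD // iterz_mul_fixed. Qed.

(** Apply [sequence_away] to the forward orbit of [p], its backward orbit and the orbit of [q];
    shifts by one skip time 0. Along residue classes the limits are points of the orbit of [q],
    which differ from [p]. *)
Lemma homoclinic_isolated : exists2 eta : R, 0 < eta &
  (forall i, i != 0 -> eta <= mdist p (iterz f i p)) /\
  (forall i, eta <= mdist p (iterz f i q)).
Proof.
have cont (i : int) (u : nat -> X) : u @ \oo --> q ->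
    iterz f i (u k) @[k --> \oo] --> iterz f i q.
  by move=> uq; apply: continuous_cvg uq; exact: continuous_iterz.
have [||r|e1 e10 e1P] := @sequence_away p N (fun i => iterz f (i%:Z + 1) p)
    (fun r => iterz f (r%:Z + 1) q) N_gt0.
- by move=> i; apply: homoclinic_aperiodic; lia.
- by move=> r; exact: homoclinic_not_periodic.
- rewrite (_ : (fun _ => _) = fun k : nat => iterz f (r%:Z + 1) (iterz f (k%:Z * N%:Z) p)).
    exact: cont.
  by apply/funext => k; rewrite -iterzD //; congr (iterz f _ p); rewrite PoszD PoszM; ring.
have [||r|e2 e20 e2P] := @sequence_away p N (fun i => iterz f (- i%:Z - 1) p)
    (fun r => iterz f (- r%:Z - 1) q) N_gt0.
- by move=> i; apply: homoclinic_aperiodic; lia.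
- by move=> r; exact: homoclinic_not_periodic.
- rewrite (_ : (fun _ => _) = fun k : nat => iterz f (- r%:Z - 1) (iterz f (k%:Z * - N%:Z) p)).
    exact: cont.
  by apply/funext => k; rewrite -iterzD //; congr (iterz f _ p); rewrite PoszD PoszM; ring.
have [||r|e3 e30 e3P] := @sequence_away p N (fun i => iterz f i%:Z q)
    (fun r => iterz f r%:Z q) N_gt0.
- by move=> i; exact: homoclinic_not_periodic.
- by move=> r; exact: homoclinic_not_periodic.
- rewrite (_ : (fun _ => _) = fun k : nat => iterz f r%:Z q); first exact: cvg_cst.
  by apply/funext => k; rewrite PoszD PoszM iterz_period.
exists (Num.min e1 (Num.min e2 e3)); first by rewrite !lt_min e10 e20.
split=> i => [i0|].
  rewrite !ge_min; have [i1|i1] := ltP 0 i.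
    have -> : i = `|i - 1|%N%:Z + 1 by lia.
    by rewrite e1P.
  have -> : i = - `|(i + 1)%R|%N%:Z - 1 by lia.
  by rewrite e2P orbT.
have [k [r [rN ->]]] := blockP i N_gt0.
by rewrite iterz_period !ge_min e3P !orbT.
Qed.

End Marker.


Section Realization.
Context {R : realType} {X : metricType R}.
Variables (f : X -> X) (S : set X) (N : nat) (p q : X).
Hypothesis f_homeo : homeomorphism f.
Hypothesis f_shadowing : shadowing_on f S.
Hypothesis N_gt0 : (0 < N)%N.
Hypothesis qN : iterz f N%:Z q = q.
Hypothesis pq : p <> q.
Hypothesis pqS : forall i, S (iterz f i p) /\ S (iterz f i q).
Hypothesis p_forward : (fun k : nat => iterz f (k%:Z * N%:Z) p) @ \oo --> q.
Hypothesis p_backward : (fun k : nat => iterz f (k%:Z * - N%:Z) p) @ \oo --> q.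

Lemma exists_marker : exists (phi : X -> R) (M : nat),
  [/\ continuous phi, (0 < M)%N &
   forall (D : set nat) (l : nat), (forall i, D i -> i = l %[mod M]) ->
     exists x, forall i, phi (iter i f x) = \1_D i].
Proof.
have [eta eta0 [etap etaq]] :=
  homoclinic_isolated f_homeo N_gt0 qN pq p_forward p_backward.
(* The bump is 1 within [eta / 3] of [p] and 0 from [2 * eta / 3] on, so shadowing at precision
   [eta / 3] decides its value. *)
pose phi z : R := Num.max 0 (Num.min 1 (2 - 3 / eta * mdist p z)).
have [delta delta0 fshadow] := f_shadowing (divr_gt0 eta0 (ltr0n _ 3)).
have delta20 : 0 < delta / 2 by rewrite divr_gt0.
(* [H] is a multiple of [N] so large that [f^H(p)] and [f^(-H)(p)] are [delta / 2]-close to [q].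
   Pieces of length [2 * H] centred at [p] or [q] then fit together with jumps below [delta], whence
   [M = 2 * H]. *)
have [H [H0 HN Hp Hn]] : exists H : nat, [/\ (0 < H)%N, iterz f H%:Z q = q,
    mdist q (iterz f H%:Z p) < delta / 2 & mdist q (iterz f (- H%:Z) p) < delta / 2].
  have [K1 _ K1P] := metricType_numDomainType.cvgr_dist_lt p_forward delta20.
  have [K2 _ K2P] := metricType_numDomainType.cvgr_dist_lt p_backward delta20.
  exists ((K1 + K2).+1 * N)%N; rewrite PoszM -mulrN; split; first by lia.
  - exact: iterz_mul_fixed.
  - by apply: K1P => /=; lia.
  - by apply: K2P => /=; lia.
have HNn : iterz f (- H%:Z) q = q.
  by rewrite -mulN1r; exact: iterz_mul_fixed.
exists phi, (H + H)%N; split; [|by lia|].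
  move=> z; apply: (@continuous_max _ X (cst 0)); first exact: cvg_cst.
  apply: (@continuous_min _ X (cst 1)); first exact: cvg_cst.
  apply: cvgB; first exact: cvg_cst.
  by apply: cvgM; [exact: cvg_cst|exact: continuous_mdistr].
move=> D l Dl.
(* Block [k] follows the orbit of [p], with [p] itself at position [H], exactly when time
   [l + k * M] is in [D]; otherwise it follows the orbit of [q]. *)
pose chosen k := `[< exists2 n : nat, D n & n%:Z = l%:Z + k * (H + H)%N%:Z >].
pose base k := if chosen k then p else q.
pose w k (r : nat) := iterz f (r%:Z - H%:Z) (base k).
have wS k r : S (w k r) by rewrite /w /base; case: ifP => _; have [] := pqS (r%:Z - H%:Z).
have [||x0 /sup_distP x0P] := fshadow (blocks (H + H) w).
- apply: pseudo_orbit_blocks => [|k r _|k]; first by lia.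
    have -> : f (w k r) = w k r.+1.
      by rewrite /w -iterz_succ //; congr (iterz f _ _); lia.
    by rewrite mdistxx ltW.
  have -> : f (w k (H + H).-1) = iterz f H%:Z (base k).
    by rewrite /w -iterz_succ //; congr (iterz f _ _); lia.
  rewrite /w sub0r.
  have h1 : mdist q (iterz f H%:Z (base k)) < delta / 2.
    by rewrite /base; case: ifP => _ //; rewrite HN mdistxx.
  have h2 : mdist q (iterz f (- H%:Z) (base (k + 1))) < delta / 2.
    by rewrite /base; case: ifP => _ //; rewrite HNn mdistxx.
  have := metric_triangle (iterz f H%:Z (base k)) q (iterz f (- H%:Z) (base (k + 1))).
  rewrite (metric_sym (iterz f H%:Z (base k)) q); lra.
- by move=> i; exact: wS.
(* The shift moves time [l] to the centre [H] of block 0. *)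
exists (iterz f (H%:Z - l%:Z) x0) => i.
have -> : iter i f (iterz f (H%:Z - l%:Z) x0) = iterz f (i%:Z + (H%:Z - l%:Z)) x0.
  by rewrite (iterzD f_homeo i%:Z).
have [k [r [rH iE]]] := blockP (i%:Z + (H%:Z - l%:Z)) (ltn_addl H H0).
have := x0P (i%:Z + (H%:Z - l%:Z)); rewrite {1}iE blocksE //.
set y := iterz f _ x0 => wy.
rewrite indicE; have [/set_mem Di|nDi] := boolP (i \in D).
  have [k' ik'] : exists k' : int, i%:Z = l%:Z + k' * (H + H)%N%:Z.
    exists ((i %/ (H + H))%N%:Z - (l %/ (H + H))%N%:Z).
    rewrite {1}(divn_eq i (H + H)) {1}(divn_eq l (H + H)) (Dl _ Di) !PoszD !PoszM; ring.
  have iE' : i%:Z + (H%:Z - l%:Z) = k' * (H + H)%N%:Z + H%:Z.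
    by rewrite ik'; ring.
  have H2 : (H < H + H)%N by lia.
  have kk' : k = k'.
    by rewrite -(divz_block k rH) -iE iE' divz_block.
  have rE : r = H.
    by apply/eqP; rewrite -eqz_nat -(modz_block k rH) -iE iE' modz_block.
  have ck : chosen k by apply/asboolP; exists i => //; rewrite kk'.
  move: wy; rewrite /w /base ck rE subrr /= => py.
  rewrite /phi (min_idPl _) ?(max_idPr _) ?ler01 //.
  suff : 3 / eta * mdist p y <= 3 / eta * (eta / 3).
    by rewrite (_ : 3 / eta * (eta / 3) = 1); [lra|field; rewrite gt_eqF].
  by rewrite ler_pM2l // divr_gt0.
(* Off [D] the pseudo orbit is at a point of the orbit of [q] or at some [f^j(p)] with [j <> 0],
   since [p] occurs only at centres of chosen blocks. *)
have pw : eta <= mdist p (w k r).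
  rewrite /w /base; case: ifP => [/asboolP[n Dn nE]|_]; last exact: etaq.
  apply: etap; apply/negP => /eqP rE; move: nDi; rewrite notin_setE; apply.
  suff -> : i = n by [].
  by apply/eqP; rewrite -eqz_nat nE; apply/eqP; move: iE rE; clear; lia.
have py : 2 * eta / 3 <= mdist p y.
  have := metric_triangle p y (w k r).
  rewrite (metric_sym y); lra.
rewrite /phi (max_idPl _) // ge_min; apply/orP; right.
suff : 3 / eta * (2 * eta / 3) <= 3 / eta * mdist p y.
  by rewrite (_ : 3 / eta * (2 * eta / 3) = 2); [lra|field; rewrite gt_eqF].
by rewrite ler_pM2l // divr_gt0.
Qed.

End Realization.

(** * From a marker to Bohr chaos *)

Lemma limn_esup_le0_cvg (R : realType) (u : nat -> R) : (forall n, 0 <= u n) ->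
  ~ (0 < limn_esup (EFin \o u))%E -> u @ \oo --> 0.
Proof.
move=> u0 /negP; rewrite -leNgt => /limn_esup_le_cvg h.
have /fine_cvg : (EFin \o u) @ \oo --> 0%E by apply: h => n; rewrite lee_fin.
by [].
Qed.

(** If none of the [2 * M] sets of times given by residue and sign were detected, all their averages
    would tend to 0, hence so would their sum, which bounds the averages of [|a i|]. *)
Lemma bohr_chaotic_of_marker (R : realType) (X : topologicalType) (f : X -> X)
    (phi : X -> R) (M : nat) : continuous phi -> (0 < M)%N ->
  (forall (D : set nat) (l : nat), (forall i, D i -> i = l %[mod M]) ->
     exists x, forall i, phi (iter i f x) = \1_D i) ->
  bohr_chaotic R f.
Proof.
move=> phi_cont M0 marker a _ a_pos; apply: contrapT => none.
pose S (D : set nat) n := n%:R^-1 * `|\sum_(0 <= i < n) a i * \1_D i|.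
have Scvg (D : set nat) (l : nat) : (forall i, D i -> i = l %[mod M]) ->
    S D @ \oo --> (0 : R).
  move=> Dl; have [x xP] := marker D l Dl.
  apply: limn_esup_le0_cvg => [n|]; first by rewrite mulr_ge0 // invr_ge0.
  move=> Spos; apply: none; exists x, phi; split=> //.
  rewrite [X in limn_esup X](_ : _ = EFin \o S D) //.
  apply/funext => n /=; congr (_ * `|_|)%:E.
  by apply: eq_bigr => i _; rewrite xP.
pose Dpos (l : 'I_M) := [set i : nat | (i %% M)%N = l /\ 0 < a i].
pose Dneg (l : 'I_M) := [set i : nat | (i %% M)%N = l /\ a i < 0].
pose A n := n%:R^-1 * \sum_(0 <= i < n) `|a i|.
have Acvg : A @ \oo --> (0 : R).
  have Bcvg : (fun n => \sum_(l < M) (S (Dpos l) n + S (Dneg l) n)) @ \oo --> \sum_(l < M) (0 : R).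
    apply: (@cvg_big R _ +%R 0 xpredT _ _ \oo) => [|l _].
      exact: add_continuous.
    rewrite -[0]addr0.
    by apply: cvgD; apply: (Scvg _ l) => i [il _]; rewrite il modn_small.
  rewrite big1 // in Bcvg.
  apply: (squeeze_cvgr _ (cvg_cst 0) Bcvg); apply: nearW => n.
  have n0 : 0 <= n%:R^-1 :> R by rewrite invr_ge0.
  apply/andP; split; first by rewrite mulr_ge0 // sumr_ge0.
  rewrite /A.
  (* Only the residue class of [i] contributes, and there the sign of [a i] decides which of the two
     sums yields [|a i|]. *)
  have -> : \sum_(0 <= i < n) `|a i| = \sum_(l < M)
      (\sum_(0 <= i < n) a i * \1_(Dpos l) i - \sum_(0 <= i < n) a i * \1_(Dneg l) i).
    under [RHS]eq_bigr do rewrite -sumrB.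
    rewrite exchange_big /=; apply: eq_bigr => i _.
    have iM : (i %% M < M)%N by rewrite ltn_pmod.
    rewrite (bigD1 (Ordinal iM)) //= big1 ?addr0 => [|l il]; last first.
      rewrite !indicE !memNset ?mulr0 ?subrr // => -[iE _]; move/eqP: il; apply;
        exact/val_inj.
    rewrite !indicE; have [a0|a0|a0] := ltgtP (a i) 0.
    - rewrite (memNset (_ : ~ Dpos _ i)) => [|[_]]; last by rewrite ltNge ltW.
      by rewrite (mem_set (_ : Dneg _ i)) // mulr0 mulr1 sub0r ltr0_norm.
    - rewrite (memNset (_ : ~ Dneg _ i)) => [|[_]]; last by rewrite ltNge ltW.
      by rewrite (mem_set (_ : Dpos _ i)) // mulr0 mulr1 subr0 gtr0_norm.
    - by rewrite a0 normr0 !mul0r subr0.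
  rewrite mulr_sumr; apply: ler_sum => l _.
  rewrite /S -mulrDr ler_wpM2l //; apply: le_trans (ler_norm _) _.
  exact: ler_normB.
move: a_pos; rewrite [X in limn_esup X](_ : _ = EFin \o A) //.
have /cvg_limn_einf_sup[_ ->] : (EFin \o A) @ \oo --> 0%E by apply: cvg_EFin; [exact: nearW|].
by rewrite ltxx.
Qed.

Theorem theorem3 (R : realType) (X : metricType R)
    (X_compact : compact [set: X])
    (f : X -> X) (f_homeo : homeomorphism f)
    (L : set X) (L_closed : closed L) (L_inv : f @` L = L)
    (L_uncountable : ~ countable L)
    (b : R) (b_gt0 : 0 < b)
    (f_expansive : expansive_on f (cball_around b L))
    (f_shadowing : shadowing_on f (cball_around b L)) :
  bohr_chaotic R f.
Proof.
have [N [p [q [[N0 qN] pq pqS pf pb]]]] := exists_homoclinic X_compact f_homeo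
  L_closed L_inv L_uncountable b_gt0 f_expansive f_shadowing.
have [phi [M [phi_cont M0 marker]]] :=
  exists_marker f_homeo f_shadowing N0 qN pq pqS pf pb.
exact: bohr_chaotic_of_marker phi_cont M0 marker.
Qed.
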